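(* Let $d\ge 2$, $k\ge 1$, let $E\subset\mathbb{R}^d$ be compact, let $\mu$ be a Frostman measure on $E$, and let $\nu_k$ be the measure induced by $\mu$ (see context). Suppose that $\dim_{\mathcal H}(E)>s_{k,d}$. Then there exist distinct $r_1,r_2>0$ with $\nu_k\big(\Delta_k^{r_1}(E)\cap\Delta_k^{r_2}(E)\big)>0$. In fact, for any partition $(0,\infty)=\coprod_{\alpha\in A}R_\alpha$ with each $R_\alpha$ nonempty and countable, there exist distinct $\alpha_1,\alpha_2\in A$ and $r_1\in R_{\alpha_1}$, $r_2\in R_{\alpha_2}$ such that $\nu_k\big(\Delta_k^{r_1}(E)\cap\Delta_k^{r_2}(E)\big)>0$.
   Context: A Frostman measure on a compact set $E\subset\mathbb{R}^d$ is a nonzero finite positive Borel measure $\mu$ supported on $E$ with $\mu(B(x,\rho))\le C\rho^{s}$ for all $x\in\mathbb{R}^d$, $\rho>0$, for some exponent $s>0$ (less than $\dim_{\mathcal H}E$). Configuration map. For $x^1,\dots,x^{k+1}\in\mathbb{R}^d$: if $k\le d$, let $\vec v_{k,d}(x^1,\dots,x^{k+1})\in\mathbb{R}^{k(k+1)/2}$ be the vector with entries $|x^i-x^j|$, $1\le i<j\le k+1$, in lexicographic order; set $D=k(k+1)/2$. If $k>d$, let $m=d(k+1)-\binom{d+1}{2}$ and fix once and for all a set $P$ of $m$ edges of the complete graph on $\{1,\dots,k+1\}$ which is maximally independent in $\mathbb{R}^d$ (specifying the lengths $|x^i-x^j|$, $(i,j)\in P$, determines all other pairwise distances up to finitely many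 possibilities); then $\vec v_{k,d}(x^1,\dots,x^{k+1})=(|x^i-x^j|)_{(i,j)\in P}\in\mathbb{R}^m$ in lexicographic order, and set $D=m$. The measure $\nu_k$ on $\mathbb{R}^D$ is defined by $\int f\,d\nu_k=\int\cdots\int f(\vec v_{k,d}(x^1,\dots,x^{k+1}))\,d\mu(x^1)\cdots d\mu(x^{k+1})$ for $f\in C_0(\mathbb{R}^D)$. The configuration set is $\Delta_k(E)=\{\vec v_{k,d}(x^1,\dots,x^{k+1}): x^j\in E\}\subset\mathbb{R}^D$, and for $r>0$, $\Delta_k^r(E)=\{\vec t\in\Delta_k(E): r\vec t\in\Delta_k(E)\}$. The $L^2$-threshold is $s_{k,d}=\inf\{s:\ \dim_{\mathcal H}(E)>s\implies \nu_k \text{ has a density with }\int_{\Delta_k(E)}\nu_k^2(\vec t)\,d\vec t<\infty\}$, where $E$ ranges over all compact subsets of $\mathbb{R}^d$ (with $\nu_k$ induced by a Frostman measure on $E$).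
   Formalization: The Frostman measure μ is assumed to have an exponent t with s_{k,d} < t < dim_H(E), and the threshold s_{k,d} is read as the infimum of s such that every Frostman measure of exponent greater than s on a compact E with dim_H(E) > s gives ν_k an L² density. *)

(* Defs.v *)
From HB Require Import structures.
From mathcomp Require Import all_boot all_order all_algebra.
From mathcomp Require Import all_classical all_reals all_analysis.
Unset Printing Implicit Defensive.
Import Order.TTheory GRing.Theory Num.Theory.
Import numFieldNormedType.Exports.
Local Open Scope classical_set_scope.
Local Open Scope ring_scope.

Section Defs.
Variable R : realType.

Definition eucl (d : nat) (x : 'rV[R]_d) : R := Num.sqrt (\sum_(i < d) x ord0 i ^+ 2).

Definition eball (d : nat) (x : 'rV[R]_d) (rho : R) : set 'rV[R]_d :=
  [set y | eucl d (y - x) < rho].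

Definition Rborel (d : nat) := g_sigma_algebraType (@open 'rV[R]_d).
Definition borel_set (d : nat) (A : set 'rV[R]_d) : Prop := <<s @open 'rV[R]_d >> A.

(* diam(U)^s, with the conventions diam(empty)^s = 0 and 0^0 = 1 *)
Definition diam_pow (d : nat) (s : R) (U : set 'rV[R]_d) : \bar R :=
  maxe 0%E (ereal_sup [set ((eucl d (x - y)) `^ s)%:E | x in U & y in U]).

Definition hausdorff_delta (d : nat) (s delta : R) (E : set 'rV[R]_d) : \bar R :=
  ereal_inf [set (\sum_(0 <= i <oo) diam_pow d s (U i))%E | U in
    [set U : nat -> set 'rV[R]_d | E `<=` \bigcup_i U i /\
       (forall i x y, U i x -> U i y -> eucl d (x - y) <= delta)]].

Definition hausdorff_measure (d : nat) (s : R) (E : set 'rV[R]_d) : \bar R :=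
  ereal_sup [set hausdorff_delta d s delta E | delta in [set delta : R | 0 < delta]].

Definition hdim (d : nat) (E : set 'rV[R]_d) : \bar R :=
  ereal_inf [set s%:E | s in [set s : R | 0 <= s /\ hausdorff_measure d s E = 0%E]].

Definition frostman (d : nat) (E : set 'rV[R]_d)
    (mu : {measure set (Rborel d) -> \bar R}) (s : R) : Prop :=
  0 < s /\ (mu setT < +oo)%E /\ (0 < mu setT)%E /\ mu (~` E) = 0%E /\
  exists C : R, forall (x : 'rV[R]_d) (rho : R), 0 < rho ->
     (mu (eball d x rho) <= (C * rho `^ s)%:E)%E.

(* vertices are 0, ..., k (standing for x^1, ..., x^{k+1}) *)
Definition lexlt (a b : nat * nat) : bool :=
  (a.1 < b.1)%N || ((a.1 == b.1) && (a.2 < b.2)%N).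

Definition all_pairs (k : nat) : seq (nat * nat) :=
  [seq (i, j) | i <- iota 0 k.+1, j <- [seq j <- iota 0 k.+1 | (i < j)%N]].

(* P is a maximally independent set of edges of K_{k+1} in R^d
   (given in lexicographic order): m = d(k+1) - binom(d+1,2) edges whose rows
   in the rigidity matrix are linearly independent at some configuration,
   i.e. there is a configuration admitting no nonzero self-stress on P. *)
Definition max_independent (d k : nat) (P : seq (nat * nat)) : Prop :=
  size P = (d * k.+1 - 'C(d.+1, 2))%N /\ uniq P /\ sorted lexlt P /\
  all (fun e => (e.1 < e.2)%N && (e.2 < k.+1)%N) P /\
  exists xs : seq 'rV[R]_d, size xs = k.+1 /\
    forall w : nat -> R,
      (forall v, (v < k.+1)%N ->
         \sum_(e < size P)
            (if (nth (0,0) P e).1 == v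
             then w e *: (nth 0 xs v - nth 0 xs (nth (0,0) P e).2)
             else if (nth (0,0) P e).2 == v
             then w e *: (nth 0 xs v - nth 0 xs (nth (0,0) P e).1)
             else 0) = 0) ->
      forall e, (e < size P)%N -> w e = 0.

Definition cfg_edges (d k : nat) (P : seq (nat * nat)) : seq (nat * nat) :=
  if (k <= d)%N then all_pairs k else P.

Definition cdim (d k : nat) (P : seq (nat * nat)) : nat := size (cfg_edges d k P).

Definition vmap (d k : nat) (P : seq (nat * nat)) (xs : seq 'rV[R]_d)
    : 'rV[R]_(cdim d k P) :=
  \row_(e < cdim d k P)
     eucl d (nth 0 xs (nth (0,0) (cfg_edges d k P) e).1
           - nth 0 xs (nth (0,0) (cfg_edges d k P) e).2).

Definition Delta (d k : nat) (P : seq (nat * nat)) (E : set 'rV[R]_d)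
    : set 'rV[R]_(cdim d k P) :=
  [set t | exists xs : seq 'rV[R]_d,
       size xs = k.+1 /\ (forall x, x \in xs -> E x) /\ vmap d k P xs = t].

Definition Delta_r (d k : nat) (P : seq (nat * nat)) (E : set 'rV[R]_d) (r : R)
    : set 'rV[R]_(cdim d k P) :=
  [set t | Delta d k P E t /\ Delta d k P E (r *: t)].

Fixpoint itint (d : nat) (mu : {measure set (Rborel d) -> \bar R}) (n : nat)
    (F : seq 'rV[R]_d -> \bar R) : \bar R :=
  match n with
  | 0 => F [::]
  | n.+1 => (\int[mu]_x itint d mu n (fun xs => F (x :: xs)))%E
  end.

(* nu_k(A) = (mu x ... x mu)(vmap^{-1}(A)) *)
Definition nu (d k : nat) (P : seq (nat * nat))
    (mu : {measure set (Rborel d) -> \bar R}) (A : set 'rV[R]_(cdim d k P))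
    : \bar R :=
  itint d mu k.+1 (fun xs => (\1_A (vmap d k P xs))%:E).

Fixpoint itleb (n : nat) (g : seq R -> \bar R) : \bar R :=
  match n with
  | 0 => g [::]
  | n.+1 => (\int[@lebesgue_measure R]_t itleb n (fun s => g (t :: s)))%E
  end.

Definition leb_int (D : nat) (g : 'rV[R]_D -> \bar R) : \bar R :=
  itleb D (fun s => g (\row_(i < D) nth 0 s i)).

Definition has_L2_density (d k : nat) (P : seq (nat * nat)) (E : set 'rV[R]_d)
    (mu : {measure set (Rborel d) -> \bar R}) : Prop :=
  exists f : 'rV[R]_(cdim d k P) -> R,
    (forall t, 0 <= f t) /\
    measurable_fun setT (f : Rborel (cdim d k P) -> R) /\
    (forall A, borel_set (cdim d k P) A -> nu d k P mu A = leb_int (cdim d k P) (fun t => (\1_A t * f t)%:E)) /\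
    (leb_int (cdim d k P) (fun t => (\1_(Delta d k P E) t * f t ^+ 2)%:E) < +oo)%E.

Definition s_thr (d k : nat) (P : seq (nat * nat)) : \bar R :=
  ereal_inf [set s%:E | s in [set s : R |
    forall (E : set 'rV[R]_d) (mu : {measure set (Rborel d) -> \bar R}) (t : R),
      compact E -> (s%:E < hdim d E)%E -> frostman d E mu t -> s < t ->
      has_L2_density d k P E mu]].

End Defs.

(* Main.v *)
Require Import Defs.
From HB Require Import structures.
From mathcomp Require Import all_boot all_order all_algebra.
From mathcomp Require Import all_classical all_reals all_analysis.
From mathcomp Require Import measurable_realfun.
Import Order.TTheory GRing.Theory Num.Theory.
Import numFieldNormedType.Exports.
Local Open Scope classical_set_scope.
Local Open Scope ring_scope.

(** Let [K] be the compact configuration set and [N] the measure with density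
    [f].  Since [nu] lives on [K], the heart of the matter is that the set [G] of
    ratios [r] with [N (K /\ r^-1 K) > 0] is uncountable.  Only the absolute
    continuity of [nu] is needed: were [G] countable, one could choose [y] in
    ]0, 1[ such that no ratio of two distinct numbers [r_i = exp (y / (i + 1))]
    lies in [G].  Removing from [K] the [N]-null sets on which [t] and
    [(r_i / r_j) t] both lie in [K] leaves a set [Z] with [N Z = N K > 0], hence
    of positive Lebesgue measure, whose dilates [r_i Z] are pairwise disjoint,
    stay in a bounded box and have measure at least that of [Z]: impossible.
    Since the classes of the partition are countable, uncountably many of them
    meet [G], and a finite measure has only countably many sets of positive
    measure with pairwise null intersections. *)

(** * Iterated Lebesgue integrals: measurability, series and null sets *)

Section iterated.
Variable R : realType.
Local Notation leb := (@lebesgue_measure R).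

(* Joint measurability of [g : X -> R^n -> Y] for the product sigma-algebra, the
   [n] real arguments being passed as a sequence; moving them one by one into the
   parameter space avoids a type of iterated products. *)
Fixpoint imeas (n : nat) : forall (d : measure_display) (X : measurableType d)
    (d' : measure_display) (Y : measurableType d'), (X -> seq R -> Y) -> Prop :=
  match n with
  | 0 => fun d X d' Y g => measurable_fun setT (fun x => g x [::])
  | m.+1 => fun d X d' Y g =>
      imeas m _ (X * R)%type _ Y (fun p s => g p.1 (p.2 :: s))
  end.
Arguments imeas n {d X d' Y} g.

Lemma imeas_reparam n : forall d (X : measurableType d) d1 (X' : measurableType d1)
    d' (Y : measurableType d') (g : X -> seq R -> Y) (phi : X' -> X),
  measurable_fun setT phi -> imeas n g -> imeas n (fun x => g (phi x)).
Proof.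
elim: n => [|n IH] d X d1 X' d' Y g phi mphi /= mg.
  exact: (measurableT_comp mg).
refine (IH _ _ _ _ _ _ (fun p s => g p.1 (p.2 :: s))
  (fun p : X' * R => (phi p.1, p.2)) _ mg).
apply: measurable_fun_pair; last exact: measurable_snd.
by apply: measurableT_comp => //; exact: measurable_fst.
Qed.

(** The parameter space [unit] encodes measurability in the sequence alone; [t |-> (tt, t)] then
    removes the dummy factor of [unit * R]. *)
Lemma imeas_section n d' (Y : measurableType d') (g : seq R -> Y) :
  imeas n.+1 (fun _ : unit => g) -> imeas n (fun (t : R) s => g (t :: s)).
Proof.
move=> /= mg.
refine (imeas_reparam n _ _ _ _ _ _ _ (fun t : R => (tt, t)) _ mg).
exact: pair1_measurable.
Qed.

Lemma imeas_comp n d1 (Y : measurableType d1) d2 (Z : measurableType d2)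
    (h : Y -> Z) : measurable_fun setT h ->
  forall d (X : measurableType d) (g : X -> seq R -> Y),
  imeas n g -> imeas n (fun x s => h (g x s)).
Proof.
move=> mh; elim: n => [|n IH] d X g /= mg; first exact: (measurableT_comp mh).
exact: IH.
Qed.

Lemma imeas_const n : forall d (X : measurableType d) d' (Y : measurableType d')
  (phi : X -> Y), measurable_fun setT phi -> imeas n (fun x _ => phi x).
Proof.
elim: n => [|n IH] d X d' Y phi mphi //=.
apply: (IH _ _ _ _ (fun p : X * R => phi p.1)).
by apply: measurableT_comp => //; exact: measurable_fst.
Qed.

Lemma imeas_nth n : forall i d (X : measurableType d),
  imeas n (fun (_ : X) (s : seq R) => (nth 0 s i : R)).
Proof.
elim: n => [|n IH] i d X /=.
  by rewrite nth_nil; exact: measurable_cst.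
case: i => [|i] /=; last exact: IH.
refine (imeas_const n _ _ _ _ (fun p : X * R => p.2) _).
exact: measurable_snd.
Qed.

(** The Borel sets of [Rborel] come from open sets, not from a product; both agree because an open
    set is a countable union of cubes with rational data. *)
Lemma measurable_fun_rowP d (X : measurableType d) D (psi : X -> Rborel R D) :
  (forall i, measurable_fun setT (fun x => (psi x : 'rV[R]_D) ord0 i : R)) ->
  measurable_fun setT psi.
Proof.
move=> mpsi; apply: (@measurability _ _ X (Rborel R D) setT psi (@open 'rV[R]_D)) => //.
move=> _ [U oU <-]; rewrite setTI.
pose c (q : 'rV[rat]_D) : 'rV[R]_D := map_mx ratr q.
pose B (p : 'rV[rat]_D * nat) : set 'rV[R]_D :=
  [set u | forall i, `|c p.1 ord0 i - u ord0 i| < p.2.+1%:R^-1].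
have -> : psi @^-1` U = \bigcup_(p in [set p | B p `<=` U]) psi @^-1` B p.
  apply/seteqP; split=> [x Ux|x [p Bp]]; last exact: Bp.
  have /nbhs_ballP [e /= e0 be] := open_nbhs_nbhs (conj oU Ux).
  (* A rational centre within [1 / (n + 1)] of [psi x] then has its cube of that radius inside the
     [e]-ball about [psi x]. *)
  have [n n_e] : exists n : nat, n.+1%:R^-1 < e / 2.
    have [n _ /(_ n (leqnn n)) /= H] :=
      near_infty_natSinv_lt (PosNum (divr_gt0 e0 (ltr0n R 2))).
    by exists n.
  have n0 : 0 < n.+1%:R^-1 :> R by rewrite invr_gt0.
  have /choice[q qP] : forall i, exists q : rat,
      `|ratr q - (psi x : 'rV[R]_D) ord0 i| < n.+1%:R^-1.
    move=> i; have := @rat_in_itvoo R ((psi x : 'rV[R]_D) ord0 i - n.+1%:R^-1)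
      ((psi x : 'rV[R]_D) ord0 i + n.+1%:R^-1).
    case; first by rewrite ltrD2l gtrN.
    by move=> q; rewrite in_itv /= -ltr_distlC distrC => ?; exists q.
  exists (\row_i q i, n); last by move=> i /=; rewrite !mxE.
  move=> u /= Bu; apply: be; split => // i j; rewrite (ord1 i).
  have := Bu j; rewrite /= !mxE => Bj.
  rewrite /ball /= (le_lt_trans (ler_distD (ratr (q j)) _ _))//.
  rewrite [e]splitr ltrD// (lt_trans _ n_e)// distrC.
  exact: qP.
rewrite bigcup_mkcond; apply: countable_bigcupT_measurable => [|p].
  exact: countableP.
case: ifP => _ //.
rewrite (_ : _ @^-1` _ = \bigcap_i
    (fun x => (psi x : 'rV[R]_D) ord0 i : R) @^-1` ball (c p.1 ord0 i) p.2.+1%:R^-1).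
  apply: fin_bigcap_measurable => // i _; rewrite -[X in measurable X]setTI.
  by apply: mpsi => //; exact: measurable_ball.
by apply/seteqP; split=> x H i => [_|]; exact: H.
Qed.

Lemma imeas_row D n d (X : measurableType d) :
  imeas n (fun (_ : X) (s : seq R) => (\row_(i < D) nth 0 s i : Rborel R D)).
Proof.
have H : forall d (X : measurableType d) (g : X -> seq R -> Rborel R D),
  (forall i, imeas n (fun x s => (g x s : 'rV[R]_D) ord0 i : R)) -> imeas n g.
  elim: n => [|n IH] d1 X1 g /= mg; first exact: measurable_fun_rowP.
  by apply: IH => i; exact: mg.
apply: H => i.
rewrite (_ : (fun _ => _) = fun _ s => nth 0 s i); first exact: imeas_nth.
by apply/funext => x; apply/funext => s; rewrite mxE.
Qed.

Lemma itleb_ge0 n : forall g : seq R -> \bar R,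
  (forall s, 0 <= g s)%E -> (0 <= itleb R n g)%E.
Proof.
elim: n => [|n IH] g g0 //=.
by apply: integral_ge0 => t _; exact: IH.
Qed.

Lemma itleb0 n : itleb R n (fun=> 0%E) = 0%E.
Proof.
by elim: n => [|n IH] //=; apply: integral0_eq => t _; rewrite IH.
Qed.

(** Tonelli, once per coordinate: the induction hypothesis is applied over [X * R], with the
    outermost variable as an extra parameter. *)
Lemma measurable_itleb n : forall d (X : measurableType d) (g : X -> seq R -> \bar R),
  (forall x s, 0 <= g x s)%E -> imeas n g ->
  measurable_fun setT (fun x => itleb R n (g x)).
Proof.
elim: n => [|n IH] d X g g0 mg //=.
apply: (measurable_fun_fubini_tonelli_F
  (m2 := leb) (fun p => itleb R n (fun s => g p.1 (p.2 :: s)))).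
  by apply: (IH _ _ (fun (p : X * R) s => g p.1 (p.2 :: s))).
by move=> p; exact: itleb_ge0.
Qed.

Lemma measurable_itleb1 n (g : seq R -> \bar R) :
  (forall s, 0 <= g s)%E -> imeas n.+1 (fun _ : unit => g) ->
  measurable_fun setT (fun t : R => itleb R n (fun s => g (t :: s))).
Proof.
move=> g0 mg.
by apply: measurable_itleb => //; exact: imeas_section.
Qed.

Lemma imeas_fix n d (X : measurableType d) d' (Y : measurableType d')
   (g : X -> seq R -> Y) (x : X) :
  imeas n g -> imeas n (fun _ : unit => g x).
Proof.
by apply: (imeas_reparam n _ _ _ _ _ _ _ (fun _ : unit => x)); exact: measurable_cst.
Qed.

Lemma imeas_slice n (g : seq R -> \bar R) (t : R) :
  imeas n.+1 (fun _ : unit => g) -> imeas n (fun _ : unit => (fun s => g (t :: s))).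
Proof. by move=> /imeas_section; exact: imeas_fix. Qed.

Lemma itleb_nneseries n : forall g : nat -> seq R -> \bar R,
  (forall i s, 0 <= g i s)%E -> (forall i, imeas n (fun _ : unit => g i)) ->
  itleb R n (fun s => \sum_(i <oo) g i s)%E = (\sum_(i <oo) itleb R n (g i))%E.
Proof.
elim: n => [|n IH] g g0 mg //=.
rewrite -integral_nneseries //=.
- by apply: eq_integral => t _; apply: IH => // i; exact: imeas_slice.
- by move=> i; exact: measurable_itleb1.
- by move=> i t _; exact: itleb_ge0.
Qed.

(** A zero integral of a nonnegative function makes the inner integral vanish for almost every [t],
    and the induction hypothesis applies to each such slice. *)
Lemma itleb_eq0 n : forall g h : seq R -> \bar R,
  (forall s, 0 <= g s)%E -> (forall s, 0 <= h s)%E ->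
  (forall s, g s = 0 -> h s = 0)%E ->
  imeas n (fun _ : unit => g) -> imeas n (fun _ : unit => h) ->
  itleb R n g = 0%E -> itleb R n h = 0%E.
Proof.
elim: n => [|n IH] g h g0 h0 gh mg mh /=; first exact: gh.
move=> G0.
have mG := measurable_itleb1 n g g0 mg.
have mH := measurable_itleb1 n h h0 mh.
have /(ae_eq_integral_abs leb measurableT mG) G0' :
  (\int[leb]_t `|itleb R n (fun s => g (t :: s))| = 0)%E.
  by rewrite -[RHS]G0; apply: eq_integral => t _; rewrite gee0_abs// itleb_ge0.
rewrite (ae_eq_integral (cst 0%E)) ?integral0//.
apply: filterS G0' => t /= H _; apply: (IH (fun s => g (t :: s))) => //.
- by move=> s; exact: gh.
- exact: imeas_slice.
- exact: imeas_slice.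
- exact: H.
Qed.

End iterated.

(** * Measures on rows given by a density *)

Section leb_measure.
Variables (R : realType) (D : nat).
Local Notation T := (Rborel R D).

(* [int_A g], in the form in which [has_L2_density] writes it. *)
Definition wleb (g : T -> R) (A : set T) : \bar R :=
  leb_int R D (fun t => (\1_A (t : T) * g t)%:E).

Lemma imeas_wleb (g : T -> R) (A : set T) :
  measurable_fun setT g -> measurable A ->
  imeas R D _ unit _ _ (fun _ s => (\1_A (\row_(i < D) nth 0 s i : T)
    * g (\row_(i < D) nth 0 s i))%:E).
Proof.
move=> mg mA.
have mh : measurable_fun setT (fun t : T => (\1_A t * g t)%:E).
  by apply/measurable_EFinP/measurable_funM => //; exact: measurable_indic.
exact: (imeas_comp R D _ _ _ _ _ mh _ _ _ (imeas_row R D D _ _)).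
Qed.

Section weight.
Variable g : T -> R.
Hypotheses (g0 : forall t, 0 <= g t) (mg : measurable_fun setT g).

Let wleb0 : wleb g set0 = 0%E.
Proof.
rewrite /wleb /leb_int; under eq_fun do rewrite indic0 mul0r.
exact: itleb0.
Qed.

Let wleb_ge0 A : (0 <= wleb g A)%E.
Proof. by apply: itleb_ge0 => s; rewrite lee_fin mulr_ge0. Qed.

Let wleb_sigma_additive : semi_sigma_additive (wleb g).
Proof.
move=> F mF tF mUF.
rewrite [X in _ --> X](_ : _ = \sum_(i <oo) wleb g (F i))%E.
  by apply: is_cvg_nneseries => // n _ _; exact: wleb_ge0.
rewrite /wleb /leb_int -itleb_nneseries.
- congr itleb; apply/funext => s; set t : T := \row_i _.
  rewrite EFinM muleC.
  (* This is the countable additivity of the Dirac mass at [t]. *)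
  have -> : (\1_(\bigcup_n F n) t)%:E = (\sum_(i <oo) (\1_(F i) t)%:E)%E :> \bar R.
    have := @measure_semi_bigcup _ _ _ (dirac t : {measure set T -> \bar R}) _ mF tF mUF.
    by [].
  rewrite -nneseriesZl; last by move=> i _; rewrite lee_fin.
  by apply: eq_eseriesr => i _; rewrite EFinM muleC.
- by move=> i s; rewrite lee_fin mulr_ge0.
- by move=> i; exact: imeas_wleb.
Qed.

Definition wleb_measure : {measure set T -> \bar R} :=
  HB.pack (wleb g) (isMeasure.Build _ _ _ (wleb g) wleb0 wleb_ge0 wleb_sigma_additive).

End weight.

(** Since [g > 0], the first integrand vanishes only off [A]. With [g = 1] this is the absolute
    continuity of the measure with density [h]. *)
Lemma wleb_eq0 (g h : T -> R) (A : set T) : measurable A ->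
  (forall t, 0 < g t) -> (forall t, 0 <= h t) ->
  measurable_fun setT g -> measurable_fun setT h ->
  wleb g A = 0%E -> wleb h A = 0%E.
Proof.
move=> mA g0 h0 mg mh.
apply: itleb_eq0.
- by move=> s; rewrite lee_fin mulr_ge0// ltW.
- by move=> s; rewrite lee_fin mulr_ge0.
- move=> s [] /eqP; rewrite mulf_eq0 => /orP[/eqP ->|]; first by rewrite mul0r.
  by rewrite gt_eqF.
- exact: imeas_wleb.
- exact: imeas_wleb.
Qed.

End leb_measure.

(** * Lebesgue measure under dilation, and boxes *)

Section scaling.
Variable R : realType.

(** Lebesgue measure is [r^-1] times its image under [t |-> r^-1 * t], so the left side is
    [r^-1 <= 1] times the right side. *)
Lemma integral_scale_ge (h : R -> \bar R) (r : R) : 1 <= r ->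
  measurable_fun setT h -> (forall t, 0 <= h t)%E ->
  (\int[@lebesgue_measure R]_t h t <= \int[@lebesgue_measure R]_t h (r^-1 * t)%R)%E.
Proof.
move=> r1 mh h0; have r0 : 0 < r by exact: lt_le_trans r1.
pose phi (t : measurableTypeR R) : measurableTypeR R := r^-1 * t.
have mphi : measurable_fun setT phi by exact: mulrl_measurable.
have rV0 : 0 <= r^-1 by rewrite invr_ge0 ltW.
pose k : {nonneg R} := NngNum rV0.
pose pf : {measure set (measurableTypeR R) -> \bar R} := pushforward lebesgue_measure phi.
pose m : {measure set (measurableTypeR R) -> \bar R} := mscale k (pf mphi).
(* Agreement on half-open intervals determines Lebesgue measure. *)
have mE (X : set R) : ocitv X -> @lebesgue_measure R X = m X.
  move=> [[a b] _ <-] /=.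
  rewrite /m /mscale /= /pushforward /= (_ : phi @^-1` _ = `]r * a, r * b]%classic).
    rewrite !lebesgue_measure_itv/= !lte_fin ltr_pM2l//.
    case: ifP => _; last by rewrite mule0.
    by rewrite -!EFinB -EFinM -mulrBr mulKf// gt_eqF.
  apply/seteqP; split=> t /=; rewrite /phi/= !in_itv/= [r^-1 * t]mulrC;
    by rewrite ltr_pdivlMr// ler_pdivrMr// ![r * _]mulrC.
have -> : (\int[@lebesgue_measure R]_t h t = \int[m]_t h t)%E.
  by apply: eq_measure_integral => A mA _; exact: (lebesgue_measure_unique mE).
rewrite /m ge0_integral_mscale//= ge0_integral_pushforward//=.
rewrite preimage_setT.
rewrite -[leRHS]mul1e lee_wpmul2r//.
  by apply: integral_ge0 => t _; exact: h0.
by rewrite lee_fin invf_le1.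
Qed.

Lemma itleb_scale_ge n (r : R) : 1 <= r -> forall g : seq R -> \bar R,
  (forall s, 0 <= g s)%E -> imeas R n _ unit _ _ (fun _ => g) ->
  imeas R n _ unit _ _ (fun _ s => g [seq (r^-1 * x)%R | x <- s]) ->
  (itleb R n g <= itleb R n (fun s => g [seq (r^-1 * x)%R | x <- s]))%E.
Proof.
move=> r1; elim: n => [|n IH] g g0 mg mgr //=.
apply: le_trans.
  apply: (integral_scale_ge _ r r1).
    exact: measurable_itleb1.
  by move=> t; exact: itleb_ge0.
apply: ge0_le_integral => //=.
- by move=> t _; exact: itleb_ge0.
- have /(measurableT_comp (measurable_itleb1 R n g g0 mg)) // :
    measurable_fun setT (fun t : R => r^-1 * t) by exact: mulrl_measurable.
- apply: (measurable_itleb1 R n (fun s => g [seq (r^-1 * x)%R | x <- s])) => //.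
- move=> t _; apply: (IH (fun s => g (r^-1 * t :: s))) => //.
    exact: (imeas_slice R n g).
  exact: (imeas_slice R n (fun s => g [seq (r^-1 * x)%R | x <- s])).
Qed.

(** The set on the right is the dilate of [A] by [r]; scaling one coordinate at a time never
    decreases the integral. *)
Lemma wleb1_scale_ge D (r : R) (A : set (Rborel R D)) : 1 <= r -> measurable A ->
  measurable ([set t | A (r^-1 *: t)] : set (Rborel R D)) ->
  (wleb R D (cst 1%R) A <= wleb R D (cst 1%R) [set t | A (r^-1 *: t)%R])%E.
Proof.
move=> r1 mA mrA; rewrite /wleb /leb_int.
pose row s : Rborel R D := \row_(i < D) nth 0 s i.
pose B : set (Rborel R D) := [set t | A (r^-1 *: t)].
have E s : (\1_B (row s) * cst 1 (row s))%:E =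
    (\1_A (row [seq (r^-1 * x)%R | x <- s]) * cst 1 (row [seq r^-1 * x | x <- s]))%:E.
  congr EFin; rewrite /cst/= !mulr1 !indicE; congr (_%:R); congr nat_of_bool.
  have -> : row [seq (r^-1 * x)%R | x <- s] = r^-1 *: row s.
    (* Past the end of [s] both entries are the default 0, which scaling fixes. *)
    apply/rowP => i; rewrite !mxE; have [si|si] := ltnP i (size s).
      by rewrite (nth_map 0).
    by rewrite !nth_default ?size_map// mulr0.
  by apply/idP/idP; rewrite !inE.
have m1 : measurable_fun setT (cst 1 : Rborel R D -> R) by exact: measurable_cst.
have iA := imeas_wleb R D _ _ m1 mA.
have irA := imeas_wleb R D _ _ m1 mrA.
rewrite [leRHS](_ : _ = itleb R D (fun s => (\1_A (row [seq (r^-1 * x)%R | x <- s])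
   * cst 1 (row [seq (r^-1 * x)%R | x <- s]))%:E)); last first.
  by congr itleb; apply/funext => s; rewrite -E.
apply: (itleb_scale_ge D r r1 (fun s => (\1_A (row s) * cst 1 (row s))%:E)).
- by move=> s; rewrite lee_fin mulr_ge0.
- exact: iA.
- by move: irA; under [X in imeas _ _ _ _ _ _ X]eq_fun do under eq_fun do rewrite E.
Qed.

(** The indicator of a box is a product of indicators of [I], so each integration contributes a
    finite factor, the length of [I]. *)
Lemma wleb1_box_lty D (M : R) :
  (wleb R D (cst 1%R) [set t : Rborel R D | forall i, `|(t : 'rV[R]_D) ord0 i| <= M]%R < +oo)%E.
Proof.
rewrite /wleb /leb_int.
pose I : set R := `[- M, M]%classic.
have mI : measurable I by exact: measurable_itv.
have E : (fun s : seq R => (\1_[set t : Rborel R D | forall i, `|(t : 'rV[R]_D) ord0 i| <= M]%R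
    (\row_(i < D) nth 0 s i : Rborel R D) * cst 1 (\row_(i < D) nth 0 s i : Rborel R D))%:E) =
   (fun s => (\prod_(i < D) \1_I (nth 0 s i))%:E) :> (seq R -> \bar R).
  apply: funext => s; congr EFin; rewrite mulr1 indicE.
  under eq_bigr do rewrite indicE.
  case: (pselect (forall i : 'I_D, `|nth 0 s i| <= M)) => H.
    rewrite mem_set => [|i]; last by rewrite mxE.
    by rewrite big1// => i _; rewrite mem_set//= /I/= in_itv/= -ler_norml.
  rewrite memNset => [|H']; last by apply: H => i; have := H' i; rewrite mxE.
  have [i /negP Hi] : exists i : 'I_D, ~ (`|nth 0 s i| <= M) by exact/existsNP.
  rewrite (bigD1 i)//= memNset ?mul0r//.
  by rewrite /I/= in_itv/= -ler_norml; exact/negP.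
rewrite [X in itleb _ _ X]E.
suff H n : exists c : R, itleb R n (fun s => (\prod_(i < n) \1_I (nth 0 s i))%:E) = c%:E /\ 0 <= c.
  by have [c [-> _]] := H D; exact: ltry.
elim: n => [|n [c [IH c0]]] /=; first by exists 1; rewrite big_ord0.
exists (fine (@lebesgue_measure R I) * c); split; last first.
  by rewrite mulr_ge0// fine_ge0.
transitivity (\int[@lebesgue_measure R]_t ((\1_I t)%:E * c%:E))%E.
  apply: eq_integral => t _.
  under [X in itleb _ _ X]eq_fun do rewrite big_ord_recl /=.
  rewrite indicE; case: (t \in I).
    by under [X in itleb _ _ X]eq_fun do rewrite mul1r; rewrite mul1e.
  by under [X in itleb _ _ X]eq_fun do rewrite mul0r; rewrite mul0e itleb0.
rewrite ge0_integralZr//; last exact/measurable_EFinP/measurable_indic.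
rewrite integral_indic// setIT EFinM fineK//.
by rewrite /I lebesgue_measure_itv /=; case: ifP.
Qed.

End scaling.

(** * A pigeonhole principle for finite measures *)

Section pigeonhole.
Context (d : measure_display) (T : measurableType d) (R : realType).
Variable m : {measure set T -> \bar R}.

(** If all pairwise intersections were null, making the sets disjoint would not change their
    measures, and infinitely many masses at least [c] would fit into a finite one. *)
Lemma measure_pigeonhole (F : nat -> set T) (c : R) :
  (m setT < +oo)%E -> 0 < c -> (forall i, measurable (F i)) ->
  (forall i, c%:E <= m (F i))%E ->
  exists i j, i <> j /\ (0 < m (F i `&` F j))%E.
Proof.
move=> mT c0 mF cF; apply: contrapT => H.
have H0 i j : i <> j -> m (F i `&` F j) = 0%E.
  move=> ij; apply/eqP; apply: contrapT => /negP; rewrite -measure_gt0 => ?.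
  by apply: H; exists i, j.
have mD i : measurable (seqDU F i).
  apply: measurableD => //; apply: bigsetU_measurable => //.
(* [seqDU F i] removes from [F i] only its finitely many null intersections with earlier sets. *)
have eD i : m (seqDU F i) = m (F i).
  apply/eqP; rewrite eq_le; apply/andP; split.
    by apply: le_measure; rewrite ?inE//; exact: subset_seqDU.
  have mU : measurable (\big[setU/set0]_(j < i) F j) by exact: bigsetU_measurable.
  rewrite (measureDI m (mF i) mU) [X in (_ + X)%E](_ : _ = 0%E) ?adde0//.
  apply/eqP; rewrite -measure_le0 big_distrr /=.
  apply: (le_trans (@Boole_inequality _ _ _ m (fun j => F i `&` F j) i _)).
    by move=> j _; exact: measurableI.
  rewrite big1// => j _; apply: H0 => ij; have := ltn_ord j.
  by rewrite -ij ltnn.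
have : (\sum_(i <oo) m (F i) < +oo)%E.
  rewrite -(eq_eseriesr (fun i _ => eD i)).
  rewrite -measure_semi_bigcup//; last exact: bigcupT_measurable.
  by apply: le_lt_trans mT; apply: le_measure; rewrite ?inE//; exact: bigcupT_measurable.
apply/negP; rewrite -leNgt leye_eq; apply/eqP/eqyP => A A0.
have [n An] : exists n : nat, A <= n%:R * c.
  exists (Num.truncn (A / c)).+1; rewrite -ler_pdivrMr// ltW//.
  exact: truncnS_gt.
apply: le_trans (nneseries_lim_ge n _) => //.
apply: (@le_trans _ _ (\sum_(0 <= i < n) c%:E)%E); last exact: lee_sum.
by rewrite sumEFin sumr_const_nat subn0 lee_fin -mulr_natl.
Qed.
End pigeonhole.

(** * Compactness and Borel measurability of configuration sets *)

Section topology.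
Variable R : realType.

(** The entry space is general because rows serve both as points of Euclidean space and as tuples of
    points. *)
Lemma row_entry_continuous (T : ptopologicalType) n (i : 'I_n) :
  continuous (fun v : 'rV[T]_n => v ord0 i).
Proof.
move=> v U /= Uv; exists (fun _ j => if j == i then U else setT).
  move=> a j; rewrite (ord1 a); case: eqP => [->//|_]; exact: filterT.
by move=> w /(_ ord0 i); rewrite eqxx.
Qed.

Lemma continuous_row (T : topologicalType) D (psi : T -> 'rV[R]_D) :
  (forall i, continuous (fun x => psi x ord0 i)) -> continuous psi.
Proof.
move=> cpsi x; apply/cvg_ballP => e e0.
have : \forall y \near x, forall i, ball (psi x ord0 i) e (psi y ord0 i).
  apply: filter_forall => i.
  by have /cvg_ballP := cpsi i x; exact.
by apply: filterS => y H; split => // a j; rewrite (ord1 a).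
Qed.

Lemma eucl_continuous d : continuous (eucl R d).
Proof.
move=> x; apply: (@continuous_comp _ _ _ (fun x : 'rV[R]_d => \sum_(i < d) x ord0 i ^+ 2)
  (@Num.sqrt R)); last exact: sqrt_continuous.
apply: continuous_big => [|i _]; first exact: add_continuous.
move=> z; apply: (@continuous_comp _ _ _ (fun x : 'rV[R]_d => x ord0 i)
  (fun z : R => z ^+ 2)); first exact: row_entry_continuous.
exact: exprn_continuous.
Qed.

(** The [(k + 1)]-fold power of [E], encoded as rows of points, is compact by Tychonoff, and the
    configuration set is its continuous image. *)
Lemma compact_Delta d k P (E : set 'rV[R]_d) :
  compact E -> compact (Delta R d k P E).
Proof.
move=> cE.
pose s (v : 'rV['rV[R]_d]_k.+1) := mkseq (fun i => v ord0 (inord i)) k.+1.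
have -> : Delta R d k P E = (vmap R d k P \o s) @`
    [set v : 'rV['rV[R]_d]_k.+1 | forall i, E (v ord0 i)].
  apply/seteqP; split=> [t [xs [sz [xsE <-]]]|t [v vE <-]].
    exists (\row_i nth 0 xs i) => /= [i|].
      by rewrite mxE; apply: xsE; rewrite mem_nth// sz.
    congr vmap; apply: (@eq_from_nth _ 0); rewrite size_mkseq ?sz// => i ik.
    by rewrite nth_mkseq// mxE inordK.
  exists (s v); rewrite size_mkseq; split => //; split => // x.
  by move=> /mapP[i _ ->].
apply: continuous_compact; last exact: (@rV_compact _ _ (fun=> E)).
apply: continuous_subspaceT; apply: continuous_row => e.
(* An index beyond [k] in an edge of [P] reads the default point 0, a constant function of [v]. *)
have cs a : continuous (fun v => nth 0 (s v) a).
  have [ak|ak] := ltnP a k.+1.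
    rewrite (_ : (fun _ => _) = fun v : 'rV['rV[R]_d]_k.+1 => v ord0 (inord a)).
      exact: row_entry_continuous.
    by apply/funext => v; rewrite nth_mkseq.
  rewrite (_ : (fun _ => _) = cst 0); first exact: cst_continuous.
  by apply/funext => v; rewrite nth_default// size_mkseq.
rewrite (_ : (fun _ => _) = eucl R d \o
  (fun v => nth 0 (s v) (nth (0, 0)%N (cfg_edges d k P) e).1
          - nth 0 (s v) (nth (0, 0)%N (cfg_edges d k P) e).2)); last first.
  by apply/funext => v; rewrite /= mxE.
move=> v; apply: continuous_comp; last exact: eucl_continuous.
exact (cvgB (cs _ v) (cs _ v)).
Qed.

Lemma closed_Rborel D (K : set 'rV[R]_D) : closed K ->
  measurable (K : set (Rborel R D)).
Proof.
move=> cK; rewrite -[K]setCK; apply: measurableC.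
by apply: sub_sigma_algebra; exact: closed_openC.
Qed.

Lemma compact_Rborel D (K : set 'rV[R]_D) : compact K ->
  measurable (K : set (Rborel R D)).
Proof. by move=> /(compact_closed (@norm_hausdorff _ _)); exact: closed_Rborel. Qed.

Lemma scale_Rborel D (r : R) (A : set (Rborel R D)) : measurable A ->
  measurable ([set t | A (r *: t)] : set (Rborel R D)).
Proof.
move=> mA; rewrite -[X in measurable X]setTI.
suff : measurable_fun setT ((fun t : 'rV[R]_D => r *: t) : Rborel R D -> Rborel R D).
  by apply.
apply: (@measurability _ _ (Rborel R D) (Rborel R D) setT _ (@open 'rV[R]_D)) => //.
move=> _ [U oU <-]; rewrite setTI; apply: sub_sigma_algebra.
by move/continuousP : (@scaler_continuous R 'rV[R]_D r); exact.
Qed.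

Lemma compact_entry_bounded D (K : set 'rV[R]_D) : compact K ->
  exists2 M : R, 0 <= M & forall t i, K t -> `|t ord0 i| <= M.
Proof.
move=> /compact_bounded [M [_ KM]].
exists (`|M| + 1); first by rewrite addr_ge0.
move=> t i Kt; apply: le_trans (KM (`|M| + 1) _ _ Kt); last first.
  by rewrite ltr_pwDr// ler_norm.
rewrite [leRHS]/Num.norm /= mx_normrE.
by apply/bigmax_geP; right => /=; exists (ord0, i).
Qed.

End topology.

(** * Total mass and support of the configuration measure *)

Section nu_facts.
Import HBNNSimple.
Variables (R : realType) (d : nat) (mu : {measure set (Rborel R d) -> \bar R}).

(* [H] may be non-measurable: every simple function below it vanishes a.e. *)
Lemma integral_eq0_off_null (E : set 'rV[R]_d) (H : 'rV[R]_d -> \bar R) :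
  measurable (E : set (Rborel R d)) -> mu (~` E) = 0%E ->
  (forall x, 0 <= H x)%E -> (forall x, E x -> H x = 0%E) ->
  (\int[mu]_x H x = 0)%E.
Proof.
move=> mE muE H0 HE; apply/eqP; rewrite eq_le integral_ge0// andbT.
rewrite ge0_integralTE//; apply: ub_ereal_sup => _ [h hH <-].
rewrite -integralT_nnsfun (ae_eq_integral (cst 0%E)) ?integral0//.
  exact/measurable_EFinP/measurable_funPT.
exists (~` E); split => //; first exact: measurableC.
move=> x /= + Ex; apply => _; apply/eqP; rewrite eq_le !lee_fin.
by rewrite fun_ge0 andbT; have := hH x; rewrite (HE x Ex) lee_fin.
Qed.

Lemma itint_ge0 n : forall F : seq 'rV[R]_d -> \bar R,
  (forall xs, 0 <= F xs)%E -> (0 <= itint R d mu n F)%E.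
Proof.
elim: n => [|n IH] F F0 //=.
by apply: integral_ge0 => x _; exact: IH.
Qed.

(** Points are peeled off one at a time: once the first lies in [E], the induction hypothesis kills
    the inner integral, and the rest is [mu]-null. *)
Lemma itint_eq0 (E : set 'rV[R]_d) n :
  measurable (E : set (Rborel R d)) -> mu (~` E) = 0%E ->
  forall F : seq 'rV[R]_d -> \bar R, (forall xs, 0 <= F xs)%E ->
  (forall xs, size xs = n -> (forall x, x \in xs -> E x) -> F xs = 0%E) ->
  itint R d mu n F = 0%E.
Proof.
move=> mE muE; elim: n => [|n IH] F F0 FE /=; first exact: FE.
apply: (integral_eq0_off_null E) => //.
  by move=> x; exact: itint_ge0.
move=> x Ex; apply: IH => // xs sz xsE; apply: FE => /=; first by rewrite sz.
by move=> y; rewrite inE => /predU1P[->//|]; exact: xsE.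
Qed.

(** The constant is the [n]-th power of the total mass of [mu]. *)
Lemma itint_cst n : (0 < mu setT)%E -> (mu setT < +oo)%E ->
  exists2 c : R, 0 < c & itint R d mu n (fun=> 1%E) = c%:E.
Proof.
move=> mu0 muoo; elim: n => [|n [c c0 IH]] /=; first by exists 1.
have mufin : mu setT \is a fin_num by rewrite ge0_fin_numE.
exists (c * fine (mu setT)); first by rewrite mulr_gt0// fine_gt0// mu0.
by under eq_integral do rewrite IH; rewrite integral_cst// EFinM fineK.
Qed.

Lemma nu_setT k P : (0 < mu setT)%E -> (mu setT < +oo)%E ->
  (0 < nu R d k P mu setT < +oo)%E.
Proof.
move=> mu0 muoo; rewrite /nu.
have [c c0 cE] := itint_cst k.+1 mu0 muoo.
rewrite (_ : (fun _ => _) = fun=> 1%E); last by apply/funext => xs; rewrite indicT.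
by rewrite cE ltry lte_fin c0.
Qed.

Lemma nu_setC_Delta k P (E : set 'rV[R]_d) : compact E -> mu (~` E) = 0%E ->
  nu R d k P mu (~` Delta R d k P E) = 0%E.
Proof.
move=> cE muE; apply: (itint_eq0 E) => //; first exact: compact_Rborel.
move=> xs sz xsE; rewrite indicE memNset//.
by apply; exists xs.
Qed.

End nu_facts.

(** * Uncountably many ratios of positive measure *)

Section dilations.
Variables (R : realType) (D : nat).
Local Notation T := (Rborel R D).

(** This is [Delta_r] for an arbitrary set [K] in place of the configuration set. *)
Definition dil (K : set T) (r : R) : set T := [set t | K t /\ K (r *: t)].

Lemma measurable_dil K r : measurable K -> measurable (dil K r).
Proof. by move=> mK; apply: measurableI => //; exact: scale_Rborel. Qed.

Lemma bigcup_null (m : {measure set T -> \bar R}) (F : nat -> set T) :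
  (forall i, measurable (F i)) -> (forall i, m (F i) = 0%E) ->
  m (\bigcup_i F i) = 0%E.
Proof.
move=> mF F0; apply/eqP; rewrite -measure_le0.
apply: (le_trans (generalized_Boole_inequality m mF _)).
  exact: bigcupT_measurable.
by rewrite eseries0.
Qed.

(** Each element of [G] and each pair [i <> j] exclude at most one [y], so countably many values are
    excluded from an interval of positive length. *)
Lemma avoid_ratios (G : set R) : countable G -> exists y : R, 0 < y < 1 /\
  forall i j : nat, i <> j ->
    ~ G (expR (y * (i.+1%:R^-1 - j.+1%:R^-1))).
Proof.
move=> cG; pose q (p : nat * nat) : R := p.1.+1%:R^-1 - p.2.+1%:R^-1.
(* For a diagonal pair the divisor is 0 and the quotient is 0 by convention, which adds at most the
   point 0 to [C]. *)
pose C := \bigcup_(p : nat * nat) (fun g : R => ln g / q p) @` G.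
have cC : countable C.
  apply: bigcup_countable => [|p _]; first exact: countableP.
  exact: sub_countable (card_image_le _ _) cG.
have [y y01 Cy] : exists2 y : R, 0 < y < 1 & ~ C y.
  apply: contrapT => H.
  have : countable (`]0, 1[%classic : set R).
    apply: sub_countable cC; apply: subset_card_le => y /=; rewrite in_itv/= => y01.
    by apply: contrapT => Cy; apply: H; exists y.
  move/countable_lebesgue_measure0; rewrite lebesgue_measure_itv /= lte_fin ltr01.
  by rewrite oppr0 adde0 => /eqP; rewrite eqe oner_eq0.
exists y; split => // i j ij Gij; apply: Cy.
exists (i, j) => //; exists (expR (y * q (i, j))) => //.
rewrite expRK mulfK// /q/= subr_eq0; apply/eqP => /invr_inj/eqP.
by rewrite eqr_nat eqSS => /eqP.
Qed.

Lemma dilations_uncountable (K : set T) (f : T -> R)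
    (f0 : forall t, 0 <= f t) (mf : measurable_fun setT f) :
  compact (K : set 'rV[R]_D) -> (0 < wleb R D f K)%E ->
  ~ countable [set r | 0 < r /\ (0 < wleb R D f (dil K r))%E].
Proof.
move=> cK NK0 cG; have mK : measurable K by exact: compact_Rborel.
have [M M0 KM] := compact_entry_bounded R D K cK.
have [y [/andP[y0 y1] yG]] := avoid_ratios _ cG.
pose N := wleb_measure R D f f0 mf.
have ge01 : forall t : T, 0 <= cst (1 : R) t by move=> t.
have m1 : measurable_fun setT (cst 1 : T -> R) by exact: measurable_cst.
pose L := wleb_measure R D (cst 1) ge01 m1.
(* Since [0 < y < 1], every [r i] lies between 1 and [expR 1]: the lower bound keeps dilates from
   shrinking, the upper one keeps them in a box. *)
pose r (i : nat) : R := expR (y / i.+1%:R).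
have r1 i : 1 <= r i by rewrite -expR0 ler_expR divr_ge0// ltW.
have r0 i : 0 < r i by exact: expR_gt0.
have rij i j : r i / r j = expR (y * (i.+1%:R^-1 - j.+1%:R^-1)).
  by rewrite /r -expRN -expRD mulrBr.
(* The diagonal must be excluded: its ratio is 1, and [dil K 1] is all of [K]. *)
pose S i j := if i == j then set0 else dil K (r i / r j).
have mS i j : measurable (S i j).
  by rewrite /S; case: ifP => // _; exact: measurable_dil.
have NS i j : N (S i j) = 0%E.
  rewrite /S; case: eqP => [_|ij]; first exact: measure0.
  apply/eqP; rewrite -[_ == _]negbK -measure_gt0; apply/negP => Np.
  by apply: (yG i j ij); rewrite -rij; split=> //; rewrite divr_gt0.
pose U := \bigcup_i \bigcup_j S i j.
have mU : measurable U by do 2 apply: bigcupT_measurable => ?.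
have NU : N U = 0%E.
  apply: bigcup_null => [i|i]; first exact: bigcupT_measurable.
  exact: bigcup_null.
pose Z := K `\` U.
have mZ : measurable Z by exact: measurableD.
have NZ : N Z <> 0%E.
  move=> NZ0; have : N K = (N Z + N (K `&` U))%E by exact: measureDI.
  have -> : N (K `&` U) = 0%E.
    by apply: (subset_measure0 _ _ _ NU) => //; exact: measurableI.
  by rewrite NZ0 adde0 => NK; move: NK0; rewrite -[wleb _ _ _ _]/(N K) NK ltxx.
have LZ : (0 < L Z)%E.
  rewrite measure_gt0; apply/eqP => LZ0; apply: NZ.
  by apply: (wleb_eq0 R D (cst 1) f Z).
(* At this point [L Z] may still be infinite, so a real lower bound is extracted. *)
have [c c0 cL] : exists2 c : R, 0 < c & (c%:E <= L Z)%E.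
  move: LZ; case: (L Z) => [x|_|//]; first by rewrite lte_fin; exists x.
  by exists 1 => //; exact: leey.
pose F i : set T := [set t | Z ((r i)^-1 *: t)].
have mF i : measurable (F i) by exact: scale_Rborel.
pose B : set T := [set t | forall i, `|(t : 'rV[R]_D) ord0 i| <= expR 1 * M].
have mB : measurable B.
  apply: compact_Rborel.
  rewrite (_ : B = [set t | forall i, `[- (expR 1 * M), expR 1 * M]%classic (t ord0 i)]).
    by apply: (@rV_compact _ _ (fun=> _)) => i; exact: segment_compact.
  by apply/seteqP; split=> t Bt i; have := Bt i; rewrite /= in_itv/= ler_norml.
have FB i : F i `<=` B.
  move=> t [Kt _] j; have := KM _ j Kt; rewrite mxE normrM normfV.
  rewrite (gtr0_norm (r0 i)) ler_pdivrMl// => /le_trans; apply.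
  rewrite ler_wpM2r// ler_expR ler_pdivrMr// mul1r (le_trans (ltW y1))//.
  by rewrite ler1n.
have LB : (L (setT `&` B) < +oo)%E by rewrite setTI; exact: wleb1_box_lty.
have cF i : (c%:E <= L (F i `&` B))%E.
  by rewrite (setIidl (FB i)); apply: (le_trans cL); exact: (wleb1_scale_ge R D (r i) Z (r1 i) mZ (mF i)).
have [i [j [ij]]] := @measure_pigeonhole _ _ _ (mrestr L mB) F c LB c0 mF cF.
(* For [t] in both dilates, [u = t / r i] lies in [Z], while [u] and [(r i / r j) u = t / r j] lie
   in [K]; so [u] is in [S i j], which was removed from [Z]. *)
rewrite (_ : F i `&` F j = set0) ?measure0 ?ltxx//.
apply/seteqP; split=> // t [[Ki Ui] [Kj _]]; apply: Ui.
exists i => //; exists j => //; rewrite /S; case: eqP => // _; split => //.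
by rewrite scalerA mulrAC divff ?mul1r// gt_eqF.
Qed.

End dilations.

(** * Uncountable families of sets under a finite measure *)

Lemma uncountable_family_intersect (d : measure_display) (T : measurableType d)
    (R : realType) (m : {measure set T -> \bar R}) (J A : Type)
    (S : J -> set T) (Rp : A -> set J) :
  (m setT < +oo)%E -> (forall r, measurable (S r)) ->
  (forall a, countable (Rp a)) ->
  ~ countable [set r | (\bigcup_a Rp a) r /\ (0 < m (S r))%E] ->
  exists (a1 a2 : A) (r1 r2 : J), a1 <> a2 /\ Rp a1 r1 /\ Rp a2 r2 /\
    (0 < m (S r1 `&` S r2))%E.
Proof.
move=> mT mS cRp; apply: contra_notP => H.
(* [An n] collects the classes reaching level [1 / (n + 1)]. If each is finite, the indices of
   positive measure lie in a countable union of countable classes. *)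
pose An (n : nat) : set A :=
  [set a | exists2 r, Rp a r & (n.+1%:R^-1%:E <= m (S r))%E].
suff finA n : finite_set (An n).
  apply: (@sub_countable _ _ _ (\bigcup_n \bigcup_(a in An n) Rp a)); last first.
    apply: bigcup_countable => [|n _]; first exact: countableP.
    by apply: bigcup_countable => [|a _]; first exact: finite_set_countable.
  apply: subset_card_le => r [[a _ ar] mr].
  have [n nr] : exists n : nat, (n.+1%:R^-1%:E <= m (S r))%E.
    move: mr; case: (m (S r)) => [x|_|//]; last by exists 0%N; exact: leey.
    rewrite lte_fin => x0.
    have [n _ /(_ n (leqnn n)) /= nx] := near_infty_natSinv_lt (PosNum x0).
    by exists n; rewrite lee_fin ltW.
  by exists n => //; exists a => //; exists r.
(* An infinite [An n] would give a sequence of distinct classes, each with a set of measure at least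
   [1 / (n + 1)], to which the pigeonhole applies. *)
apply: contrapT => /infiniteP/card_leP[f].
pose e (i : nat) : A := set_val (f (to_setT i)).
have einj : injective e.
  move=> i j /val_inj /(@inj _ _ _ f); rewrite !inE => /(_ I I).
  by move/(congr1 set_val).
have /choice[r rP] i : exists r, Rp (e i) r /\ (n.+1%:R^-1%:E <= m (S r))%E.
  by have [r ? ?] := set_valP (f (to_setT i)); exists r.
have [|i [j [ij mij]]] := @measure_pigeonhole _ _ _ m (S \o r) n.+1%:R^-1 mT _
    (fun i => mS (r i)) (fun i => (rP i).2).
  by rewrite invr_gt0.
apply: H; exists (e i), (e j), (r i), (r j); split.
  by move/einj.
by split; [exact: (rP i).1|split => //; exact: (rP j).1].
Qed.

(** * Repeated ratios in configuration sets *)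

Theorem theorem1p6 (R : realType) (d k : nat) (P : seq (nat * nat))
    (E : set 'rV[R]_d) (mu : {measure set (Rborel R d) -> \bar R}) (t : R) :
  (2 <= d)%N -> (1 <= k)%N ->
  ((d < k)%N -> max_independent R d k P) ->
  compact E ->
  frostman R d E mu t -> (t%:E < hdim R d E)%E ->
  (s_thr R d k P < t%:E)%E ->
  (s_thr R d k P < hdim R d E)%E ->
  (exists r1 r2 : R, 0 < r1 /\ 0 < r2 /\ r1 <> r2 /\
     (0 < nu R d k P mu (Delta_r R d k P E r1 `&` Delta_r R d k P E r2))%E) /\
  (forall (A : Type) (Rp : A -> set R),
     (forall a, Rp a !=set0) ->
     (forall a, countable (Rp a)) ->
     (forall a b, a <> b -> Rp a `&` Rp b = set0) ->
     \bigcup_a Rp a = `]0, +oo[%classic ->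
     exists (a1 a2 : A) (r1 r2 : R), a1 <> a2 /\ Rp a1 r1 /\ Rp a2 r2 /\
       (0 < nu R d k P mu (Delta_r R d k P E r1 `&` Delta_r R d k P E r2))%E).
Proof.
move=> _ _ _ cE frE tE st _.
have [f [f0 [mf [nuE _]]]] : has_L2_density R d k P E mu.
  (* An admissible [s] below the Frostman exponent [t] exists by definition of the infimum; it is
     also below the dimension because [t] is. *)
  move: st => /ereal_inf_lt[_ [s sP <-]]; rewrite lte_fin => st.
  by apply: (sP E mu t) => //; apply: lt_trans tE; rewrite lte_fin.
have [_ [muoo [mu0 [muE _]]]] := frE.
pose D := cdim d k P.
pose K : set (Rborel R D) := Delta R d k P E.
have cK : compact (K : set 'rV[R]_D) by exact: compact_Delta.
have mK : measurable K by exact: compact_Rborel.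
pose N := wleb_measure R D f f0 mf.
have NE (A : set (Rborel R D)) : measurable A -> nu R d k P mu A = N A.
  by move=> mA; rewrite nuE.
have /andP[nuT0 nuToo] := nu_setT R d mu k P mu0 muoo.
have NK : (0 < N K)%E.
  have : N setT = (N (setT `\` K) + N (setT `&` K))%E by exact: measureDI.
  rewrite setTD setTI -(NE _ (measurableC mK)) nu_setC_Delta// add0e => <-.
  by rewrite -NE.
have partition : forall (A : Type) (Rp : A -> set R),
   (forall a, countable (Rp a)) -> \bigcup_a Rp a = `]0, +oo[%classic ->
   exists (a1 a2 : A) (r1 r2 : R), a1 <> a2 /\ Rp a1 r1 /\ Rp a2 r2 /\
     (0 < nu R d k P mu (Delta_r R d k P E r1 `&` Delta_r R d k P E r2))%E.
  move=> A Rp cRp RpE.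
  have mdil r : measurable (dil R D K r) by exact: measurable_dil.
  have [||a1 [a2 [r1 [r2 [a12 [ar1 [ar2 Nr]]]]]]] :=
      uncountable_family_intersect _ _ _ N _ _ (dil R D K) Rp _ mdil cRp.
  - by rewrite -NE.
  - rewrite RpE (_ : [set r | _] = [set r | 0 < r /\ (0 < wleb R D f (dil R D K r))%E]).
      exact: dilations_uncountable.
    by apply/seteqP; split=> r /=; rewrite in_itv/= andbT.
  - exists a1, a2, r1, r2; do 3 split => //.
    by rewrite NE; [exact: Nr|apply: measurableI; exact: mdil].
split; last by move=> A Rp _ cRp _ RpE; exact: partition.
(* The first claim is the case of singleton classes indexed by the positive reals, where distinct
   indices are distinct ratios. *)
have [|a1 [a2 [r1 [r2 [a12 [-> [-> r12]]]]]]] :=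
    partition {r : R | 0 < r} (fun a => [set sval a]) (fun a => countable1 _).
  apply/seteqP; split=> [r [[s s0] _ ->]|r]; rewrite /= in_itv/= andbT// => r0.
  by exists (exist _ r r0).
exists (sval a1), (sval a2); split; first exact: (svalP a1).
split; first exact: (svalP a2).
by split => // /val_inj.
Qed.
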